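(* Assume (A.a) and (A.b). Let $\beta\in[0,1)$, $\lambda\in[0,\frac{\beta}{1-\beta}]$, and step sizes $\{\alpha_k\}_k\subset(0,\infty)$ with \[ \alpha_k\le\frac{(1-\beta)(1-\beta^m)}{4Lm}\ \ \forall k,\qquad\sum_{k=1}^\infty\alpha_k=\infty,\qquad\sum_{k=1}^\infty\alpha_k^3<\infty, \] and let the sequences be generated by RRM with an arbitrary (deterministic or random) sequence of permutations; the conclusions hold for every realization. Then: (a) $\sum_{k=1}^\infty\alpha_k\|\nabla f(x^k)\|^2<\infty$ and $\big(\sum_{k=1}^T\alpha_k\big)\cdot\min_{k=1,\dots,T}\|\nabla f(x^k)\|^2\to0$ as $T\to\infty$; (b) $\lim_{k\to\infty}\|\nabla f(x^k)\|=0$ and $\lim_{k\to\infty}\|\nabla f(z^k)\|=0$; in particular every accumulation point of $\{x^k\}_k$ or of $\{z^k\}_k$ is a stationary point of $f$; (c) there is $f^*\in\mathbb R$ such that $f(x^k)\to f^*$ and $f(z^k)\to f^*$.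
   Context: Let $n,d\in\mathbb N$, $f_1,\dots,f_n:\mathbb R^d\to\mathbb R$ continuously differentiable, $f:=\frac1n\sum_{i=1}^n f_i$, $[n]:=\{1,\dots,n\}$. Fix a mini-batch size $b\in\mathbb N$ with $m:=n/b\in\mathbb N$. Random reshuffling with momentum (RRM) with step sizes $\{\alpha_k\}_{k\ge1}\subset(0,\infty)$ and parameters $\beta,\lambda$ generates sequences as follows: start with $x^1=\tilde x^1\in\mathbb R^d$; for each $k=1,2,\dots$ choose a permutation $\pi^k=(\pi^k_1,\dots,\pi^k_n)$ of $[n]$, set $y_0^k=\tilde x^k$, $y_1^k=x^k$, and for $i=1,\dots,m$ compute $\hat y_i^k=y_i^k+\lambda(y_i^k-y_{i-1}^k)$, $d_i^k=\frac1b\sum_{j=(i-1)b+1}^{ib}\nabla f_{\pi^k_j}(\hat y_i^k)$, $y_{i+1}^k=y_i^k-\alpha_kd_i^k+\beta(y_i^k-y_{i-1}^k)$; then set $\tilde x^{k+1}=y_m^k$, $x^{k+1}=y_{m+1}^k$. The proxy iterates are $z^k:=\frac{1}{1-\beta}x^k-\frac{\beta}{1-\beta}\tilde x^k$. Assumption (A.a): there are $L>0$ and $\bar f\in\mathbb R$ such that each $\nabla f_i$ is $L$-Lipschitz and $f_i(x)\ge\bar f$ for all $x\in\mathbb R^d$, $i\in[n]$. Assumption (A.b): $\{\alpha_k\}_k$ is non-increasing. *)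

(* Defs.v *)
From HB Require Import structures.
From mathcomp Require Import all_boot all_order all_algebra.
From mathcomp Require Import all_classical all_reals all_analysis.
Set Implicit Arguments. Unset Strict Implicit. Unset Printing Implicit Defensive.
Import Order.TTheory GRing.Theory Num.Theory.
Import numFieldNormedType.Exports.
Local Open Scope ring_scope.

(* Euclidean norm on R^d (the library norm on 'rV is the max-norm). *)
Definition enorm {R : realType} {d : nat} (v : 'rV[R]_d) : R :=
  Num.sqrt (\sum_(j < d) (v 0 j) ^+ 2).

Definition grad {R : realType} {d : nat} (g : 'rV[R]_d -> R) (x : 'rV[R]_d)
  : 'rV[R]_d :=
  \row_(j < d) ('D_(delta_mx 0 j) g x).

Definition favg {R : realType} {d : nat} (n : nat) (F : nat -> 'rV[R]_d -> R)
  (x : 'rV[R]_d) : R :=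
  n%:R^-1 * \sum_(i < n) F i x.

(* Mini-batch direction d_i^k = (1/b) sum_{j=(i-1)b+1}^{ib} grad f_{pi_j}(yhat)
   (1-based in the paper; here the permutation pk is a sequence, 0-based,
   so pi^k_j = nth 0 pk (j-1)). *)
Definition batch_dir {R : realType} {d : nat} (F : nat -> 'rV[R]_d -> R)
  (b : nat) (pk : seq nat) (i : nat) (yhat : 'rV[R]_d) : 'rV[R]_d :=
  b%:R^-1 *: \sum_(j < b) grad (F (nth 0%N pk ((i.-1) * b + j)%N)) yhat.

(* Main.v *)
Require Import Defs.
From HB Require Import structures.
From mathcomp Require Import all_boot all_order all_algebra.
From mathcomp Require Import all_classical all_reals all_analysis.
From mathcomp Require Import ring lra.
Set Implicit Arguments. Unset Strict Implicit. Unset Printing Implicit Defensive.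
Import Order.TTheory GRing.Theory Num.Theory.
Import numFieldNormedType.Exports.
Local Open Scope ring_scope.
Local Open Scope classical_set_scope.

(** The proxies satisfy [z^{k+1} = z^k - alpha_k / (1 - beta) * sum_i d_i^k],
    so up to the drift [|yhat_i - z^k|] an epoch is a gradient step of length
    [m alpha_k / (1 - beta)] on [f].  Write [phi_k = f(z^k) - fbar],
    [V_k = |x^k - xt^k|], [h_k = |grad f(z^k)|] and
    [G_k = sqrt (2 L n phi_k)], which bounds every [|grad f_i(z^k)|].  For some
    constant [C],
      [V_{k+1} <= beta^m V_k + C alpha_k (V_k + G_k)],
      [phi_{k+1} <= phi_k - c0 alpha_k h_k^2 + C alpha_k (V_k + alpha_k G_k)^2],
      [|h_{k+1} - h_k| <= C alpha_k (V_k + G_k)].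
    Once [alpha_k] is small, [P_k = phi_k + c alpha_k V_k^2] satisfies
    [P_{k+1} <= (1 + K alpha_k^3) P_k - alpha_k (c0 h_k^2 + V_k^2)].  Since
    [sum alpha_k^3] is finite, [P_k] converges and [sum alpha_k (h_k^2 + V_k^2)]
    is finite; the contraction gives [V_k -> 0], and [h_k -> 0] because
    [h_k^3] has summable increments while [sum alpha_k] diverges.  Finally
    [|x^k - z^k| = beta / (1 - beta) * V_k] transfers everything to [x^k]. *)

(** * Euclidean norm and smooth functions *)

Definition dotv {R : realType} {d : nat} (u v : 'rV[R]_d) : R :=
  \sum_(j < d) u 0 j * v 0 j.

Section Euclid.
Context {R : realType} {d : nat}.
Implicit Types (u v w : 'rV[R]_d) (c : R).

Lemma dotvC u v : dotv u v = dotv v u.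
Proof. by apply: eq_bigr => j _; rewrite mulrC. Qed.

Lemma dotvDl u v w : dotv (u + v) w = dotv u w + dotv v w.
Proof. by rewrite -big_split; apply: eq_bigr => j _; rewrite mxE mulrDl. Qed.

Lemma dotvZl c u v : dotv (c *: u) v = c * dotv u v.
Proof. by rewrite /dotv mulr_sumr; apply: eq_bigr => j _; rewrite mxE mulrA. Qed.

Lemma dotvDr u v w : dotv u (v + w) = dotv u v + dotv u w.
Proof. by rewrite dotvC dotvDl !(dotvC u). Qed.

Lemma dotvZr c u v : dotv u (c *: v) = c * dotv u v.
Proof. by rewrite dotvC dotvZl dotvC. Qed.

Lemma dotvBl u v w : dotv (u - v) w = dotv u w - dotv v w.
Proof. by rewrite dotvDl -scaleN1r dotvZl mulN1r. Qed.

Lemma dotvv_ge0 u : 0 <= dotv u u.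
Proof. by apply: sumr_ge0 => j _; rewrite -expr2 sqr_ge0. Qed.

Lemma enorm_ge0 u : 0 <= enorm u.
Proof. exact: sqrtr_ge0. Qed.

Lemma enorm_sqr u : enorm u ^+ 2 = dotv u u.
Proof.
rewrite sqr_sqrtr; first by apply: eq_bigr => j _; rewrite expr2.
by apply: sumr_ge0 => j _; rewrite sqr_ge0.
Qed.

Lemma enorm0_eq0 u : enorm u = 0 -> u = 0.
Proof.
move=> /(congr1 (fun r => r ^+ 2)); rewrite enorm_sqr expr0n => /eqP.
rewrite psumr_eq0 => [/allP u0|j _]; last by rewrite -expr2 sqr_ge0.
apply/rowP => j; rewrite mxE; apply/eqP.
by have := u0 j (mem_index_enum j); rewrite -expr2 sqrf_eq0.
Qed.

Lemma enorm0 : enorm (0 : 'rV[R]_d) = 0.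
Proof.
apply/eqP; rewrite -sqrf_eq0 enorm_sqr /dotv big1// => j _.
by rewrite mxE mul0r.
Qed.

Lemma enormZ c u : enorm (c *: u) = `|c| * enorm u.
Proof.
apply/eqP; rewrite -(@eqrXn2 _ 2)// ?mulr_ge0 ?enorm_ge0//.
by rewrite exprMn !enorm_sqr dotvZl dotvZr real_normK ?num_real// expr2 mulrA.
Qed.

Lemma enormN u : enorm (- u) = enorm u.
Proof. by rewrite -scaleN1r enormZ normrN1 mul1r. Qed.

Lemma enormB_sym u v : enorm (u - v) = enorm (v - u).
Proof. by rewrite -enormN opprB. Qed.

(** Cauchy-Schwarz: the squared norm of [enorm v *: u - enorm u *: v] expands to
    [2 |u| |v| (|u| |v| - <u, v>)]. Zero vectors are treated apart so that [|u| |v|] can be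
    cancelled. *)
Lemma dotv_le_enorm u v : dotv u v <= enorm u * enorm v.
Proof.
have [/eqP v0|v0] := boolP (enorm v == 0).
  by rewrite v0 mulr0 (enorm0_eq0 v0) /dotv big1// => j _; rewrite mxE mulr0.
have vp : 0 < enorm v by rewrite lt_neqAle eq_sym v0 enorm_ge0.
have := dotvv_ge0 (enorm v *: u - enorm u *: v).
rewrite -scaleNr !(dotvDl, dotvDr, dotvZl, dotvZr) (dotvC v u) -!enorm_sqr.
have [/eqP u0|u0] := boolP (enorm u == 0).
  by rewrite u0 mul0r (enorm0_eq0 u0) /dotv big1// => j _; rewrite mxE mul0r.
have up : 0 < enorm u by rewrite lt_neqAle eq_sym u0 enorm_ge0.
move=> h; rewrite -subr_ge0 -(pmulr_rge0 _ (mulr_gt0 up vp)); lra.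
Qed.

Lemma enormD_sqr u v : enorm (u + v) ^+ 2 = enorm u ^+ 2 + 2 * dotv u v + enorm v ^+ 2.
Proof. by rewrite !enorm_sqr !(dotvDl, dotvDr) (dotvC v u); lra. Qed.

Lemma ler_enormD u v : enorm (u + v) <= enorm u + enorm v.
Proof.
rewrite -(@ler_pXn2r _ 2)// ?nnegrE ?addr_ge0 ?enorm_ge0// enormD_sqr.
by rewrite sqrrD; have := dotv_le_enorm u v; lra.
Qed.

Lemma ler_enormB u v : enorm (u - v) <= enorm u + enorm v.
Proof. by rewrite -(enormN v) ler_enormD. Qed.

Lemma ler_dist_enorm u v : `|enorm u - enorm v| <= enorm (u - v).
Proof.
have := ler_enormD (u - v) v; have := ler_enormD (v - u) u.
by rewrite !subrK (enormB_sym v u) ler_norml; lra.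
Qed.

Lemma ler_enorm_sum (I : Type) (r : seq I) (P : pred I) (g : I -> 'rV[R]_d) :
  enorm (\sum_(i <- r | P i) g i) <= \sum_(i <- r | P i) enorm (g i).
Proof.
elim/big_rec2 : _ => [|i s u _ h]; first by rewrite enorm0.
by apply: le_trans (ler_enormD _ _) _; rewrite lerD2l.
Qed.

(** Neighbourhoods in the topology on row vectors are balls of the max-norm; this crude comparison
    turns them into Euclidean bounds. *)
Lemma enorm_le_mx_norm u : enorm u <= d%:R * `|u|.
Proof.
have -> : u = \sum_j u 0 j *: delta_mx 0 j by exact: row_sum_delta.
apply: le_trans (ler_enorm_sum _ _ _) _.
rewrite -row_sum_delta.
have -> : d%:R * `|u| = \sum_(j < d) `|u|.
  by rewrite sumr_const card_ord mulr_natl.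
apply: ler_sum => j _; rewrite enormZ.
have -> : enorm (delta_mx 0 j : 'rV[R]_d) = 1.
  apply/eqP; rewrite -(@eqrXn2 _ 2)// ?enorm_ge0// enorm_sqr /dotv.
  rewrite (bigD1 j)//= big1 => [|i /negPf ij].
    by rewrite !mxE !eqxx mulr1 addr0 expr1n.
  by rewrite !mxE ij andbF mulr0.
rewrite mulr1 [leRHS]mx_normrE.
exact: (@le_bigmax _ _ _ 0 (fun ij => `|u ij.1 ij.2|) (ord0, j)).
Qed.

End Euclid.

(** * Gradients, the descent inequality and stationarity of cluster points *)

Section Grad.
Context {R : realType} {d : nat}.
Implicit Types (g : 'rV[R]_d -> R) (u v w : 'rV[R]_d).

Lemma derive_grad g u v : differentiable g u -> 'D_v g u = dotv (grad g u) v.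
Proof.
move=> dg; rewrite deriveE// {1}(row_sum_delta v) linear_sum.
by apply: eq_bigr => j _; rewrite linearZ /= mxE deriveE// mulrC.
Qed.

Lemma is_derive_line g w v (t : R) : (forall u, differentiable g u) ->
  is_derive t 1 (fun s : R => g (w + s *: v)) (dotv (grad g (w + t *: v)) v).
Proof.
move=> dg; rewrite -derive_grad//.
have dl : is_diff t (fun s : R => w + s *: v) (fun s => s *: v).
  by apply: is_diff_eq; rewrite add0r.
have dl' : differentiable (fun s : R => w + s *: v) t by [].
have dgl : differentiable (g \o (fun s : R => w + s *: v)) t.
  exact: (differentiable_comp dl').
apply: DeriveDef; first exact: diff_derivable.
rewrite deriveE// diff_comp//.
by rewrite /= diff_val scale1r deriveE.
Qed.

Definition lipschitz_grad (L : R) g :=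
  forall u v, enorm (grad g u - grad g v) <= L * enorm (u - v).

(** Along the segment from [w] to [u], subtract from [g] its linear part and the quadratic majorant.
    The derivative of the result is nonpositive by Cauchy-Schwarz and the Lipschitz bound, so the
    mean value theorem compares the two ends. *)
Lemma smooth_descent g (L : R) : (forall u, differentiable g u) ->
  lipschitz_grad L g -> forall u w,
  g u <= g w + dotv (grad g w) (u - w) + L / 2 * enorm (u - w) ^+ 2.
Proof.
move=> dg lg u w; set v := u - w.
pose psi := fun t : R => g (w + t *: v) - t * dotv (grad g w) v
                         - t ^+ 2 * (L / 2 * enorm v ^+ 2).
pose dpsi := fun t : R => dotv (grad g (w + t *: v)) v - dotv (grad g w) v
                          - 2 * t * (L / 2 * enorm v ^+ 2).
have psiE (t : R) : is_derive t (1 : R) psi (dpsi t).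
  have dg' := is_derive_line w v t dg.
  apply: is_derive_eq; rewrite /dpsi.
  by rewrite !scaler0 !add0r /GRing.scale /= !mulr1; lra.
have cpsi : {within `[0, 1], continuous psi}.
  by apply: derivable_within_continuous => t _; have [] := psiE t.
have [c] := MVT ltr01 (fun t _ => psiE t) cpsi.
rewrite in_itv/= => /andP[c0 c1] => h.
suff : dpsi c <= 0.
  move: h; rewrite /psi scale0r addr0 scale1r /v [w + _]addrC subrK; lra.
rewrite /dpsi -dotvBl.
have := le_trans (dotv_le_enorm _ _) (ler_wpM2r (enorm_ge0 v) (lg (w + c *: v) w)).
by rewrite [w + _]addrC addrK enormZ (gtr0_norm c0); lra.
Qed.

(** A gradient step of length [1 / L] lowers [g] by at least [|grad g|^2 / (2 L)], yet cannot go
    below [fbar]. *)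
Lemma grad_sqr_le g (L fbar : R) : 0 < L -> (forall u, differentiable g u) ->
  lipschitz_grad L g -> (forall u, fbar <= g u) ->
  forall u, enorm (grad g u) ^+ 2 <= 2 * L * (g u - fbar).
Proof.
move=> L0 dg lg gf u.
have := le_trans (gf _) (smooth_descent dg lg (u - L^-1 *: grad g u) u).
rewrite (_ : _ - _ - u = - (L^-1 *: grad g u)); last by rewrite addrAC subrr add0r.
rewrite enormN enormZ -scaleNr dotvZr -enorm_sqr.
rewrite exprMn real_normK ?num_real//.
have -> : g u + - L^-1 * enorm (grad g u) ^+ 2 +
    L / 2 * (L^-1 ^+ 2 * enorm (grad g u) ^+ 2) =
    g u - enorm (grad g u) ^+ 2 / (2 * L) by field; rewrite gt_eqF.
rewrite lerBrDr -lerBrDl ler_pdivrMr; last by rewrite mulr_gt0.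
by rewrite mulrC.
Qed.

Lemma differentiable_favg (n : nat) (F : nat -> 'rV[R]_d -> R) u :
  (forall i, (i < n)%N -> forall z, differentiable (F i) z) ->
  differentiable (favg n F) u.
Proof.
move=> dF.
have -> : favg n F = n%:R^-1 \*: (\sum_(i < n) F i).
  by apply/funext => z; rewrite /favg /= fct_sumE.
by apply: differentiableZ; apply: differentiable_sum => i; exact: dF.
Qed.

Lemma grad_favg (n : nat) (F : nat -> 'rV[R]_d -> R) u :
  (forall i, (i < n)%N -> forall z, differentiable (F i) z) ->
  grad (favg n F) u = n%:R^-1 *: \sum_(i < n) grad (F i) u.
Proof.
move=> dF.
have -> : favg n F = n%:R^-1 \*: (\sum_(i < n) F i).
  by apply/funext => z; rewrite /favg /= fct_sumE.
apply/rowP => j; rewrite !mxE summxE.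
have dFu i : (i < n)%N -> forall v, derivable (F i) u v.
  by move=> iltn v; apply: diff_derivable; exact: dF.
rewrite deriveZ/=; last by apply: derivable_sum => i; exact: dFu.
rewrite derive_sum => [|i]; last exact: dFu.
by congr (_ * _); apply: eq_bigr => i _; rewrite mxE.
Qed.

Lemma lipschitz_grad_favg (n : nat) (F : nat -> 'rV[R]_d -> R) (L : R) :
  (0 < n)%N ->
  (forall i, (i < n)%N -> forall z, differentiable (F i) z) ->
  (forall i, (i < n)%N -> lipschitz_grad L (F i)) ->
  lipschitz_grad L (favg n F).
Proof.
move=> n0 dF lF u v; rewrite !grad_favg// -scalerBr -sumrB enormZ.
rewrite ger0_norm ?invr_ge0// ler_pdivrMl ?ltr0n//.
apply: le_trans (ler_enorm_sum _ _ _) _.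
rewrite [n%:R * _]mulr_natl -[n in leRHS]card_ord -sumr_const.
by apply: ler_sum => i _; exact: lF.
Qed.

Lemma lipschitz_grad_cluster g (L : R) (x : nat -> 'rV[R]_d) p :
  0 < L -> lipschitz_grad L g ->
  (fun k => enorm (grad g (x k))) @ \oo --> 0 ->
  cluster (x @ \oo) p -> grad g p = 0.
Proof.
move=> L0 lg gx clx; apply: enorm0_eq0; apply/eqP; rewrite eq_le enorm_ge0 andbT.
apply/ler_addgt0Pl => e e0.
(* The successor keeps [D] positive when [d = 0]. *)
pose D := L * d.+1%:R.
have D0 : 0 < D by rewrite mulr_gt0.
have e2 : 0 < e / 2 by rewrite divr_gt0.
have := clx [set z | exists2 k, z = x k & enorm (grad g (x k)) < e / 2]
            (ball p (e / 2 / D)).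
case.
- move/cvgrPdist_lt : gx => /(_ _ e2).
  apply: filterS => k /=; rewrite sub0r normrN ger0_norm ?enorm_ge0// => h.
  by exists k.
- by apply: nbhsx_ballx; rewrite divr_gt0.
move=> _ [[k -> gk] pk]; rewrite -[grad g p](subrK (grad g (x k))) addr0.
apply: le_trans (ler_enormD _ _) _.
rewrite [e]splitr; apply: lerD; last exact: ltW.
apply: le_trans (lg _ _) _.
move: pk; rewrite -ball_normE /= ltr_pdivlMr// => /ltW; apply: le_trans.
rewrite /D mulrCA ler_pM2l// mulrC.
apply: le_trans (enorm_le_mx_norm _) _.
by rewrite ler_wpM2r// ler_nat.
Qed.

End Grad.

(** * Real sequences *)

Section RealSequences.
Context {R : realType}.
Implicit Types (a u v w P e h V : R ^nat).

Lemma seriesS u k : series u k.+1 = series u k + u k.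
Proof. by rewrite /series /= big_nat_recr. Qed.

Lemma cvgn_ubound u : cvgn u -> exists2 M, 0 < M & forall k, u k <= M.
Proof.
move=> /cvg_seq_bounded/pinfty_ex_gt0[M M0 uM].
by exists M => // k; rewrite (le_trans (ler_norm _)) ?uM.
Qed.

Lemma nonneg_series_is_cvg u (M : R) :
  (forall k, 0 <= u k) -> (forall k, series u k <= M) -> cvgn (series u).
Proof.
move=> u0 uM; apply: nondecreasing_is_cvgn; first exact: nondecreasing_series.
by exists M => _ [k _ <-].
Qed.

Lemma series_scale_is_cvg u (c : R) :
  cvgn (series u) -> cvgn (series (fun k => c * u k)).
Proof. exact: (@is_cvg_seriesZ _ u c). Qed.

Lemma series_add_is_cvg u v : cvgn (series u) -> cvgn (series v) ->
  cvgn (series (fun k => u k + v k)).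
Proof. exact: is_cvg_seriesD. Qed.

(** Deterministic Robbins-Siegmund: telescoping bounds [series w], and [P + series w - series e] is
    nonincreasing and bounded below. *)
Lemma quasi_decreasing_is_cvg P e w :
  (forall k, 0 <= P k) -> (forall k, 0 <= w k) -> (forall k, 0 <= e k) ->
  cvgn (series e) -> (forall k, P k.+1 <= P k + e k - w k) ->
  cvgn P /\ cvgn (series w).
Proof.
move=> P0 w0 e0 ce PS; have [M M0 eM] := cvgn_ubound ce.
have wM k : series w k + P k <= P 0%N + series e k.
  elim: k => [|k ih]; first by rewrite /series /= !big_geq// add0r addr0.
  by rewrite !seriesS; have := PS k; lra.
have cw : cvgn (series w).
  apply: (@nonneg_series_is_cvg _ (P 0%N + M)) => // k.
  by have := wM k; have := P0 k; have := eM k; lra.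
split=> //.
have cQ : cvgn (fun k => P k + (series w k - series e k)).
  apply: nonincreasing_is_cvgn.
    apply/nonincreasing_seqP => k; rewrite !seriesS.
    by have := PS k; lra.
  exists (- M) => _ [k _ <-]; have := P0 k; have := eM k.
  have : 0 <= series w k by rewrite /series /=; exact: sumr_ge0.
  lra.
have -> : P = (fun k => P k + (series w k - series e k)) -
              (series w - series e).
  by apply/funext => k; rewrite /= !fctE; lra.
by apply: is_cvgB => //; exact: is_cvgB.
Qed.

(** From [1 + t <= exp t], the product of the factors is at most the exponential of the sum. *)
Lemma discrete_gronwall P a : (forall k, 0 <= P k) ->
  (forall k, P k.+1 <= (1 + a k) * P k) ->
  forall k, P k <= P 0%N * expR (series a k).
Proof.
move=> P0 PS; elim=> [|k ih]; first by rewrite /series /= big_geq// expR0 mulr1.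
rewrite seriesS expRD; apply: le_trans (PS k) _.
apply: (@le_trans _ _ (expR (a k) * P k)).
  by rewrite ler_wpM2r// expR_ge1Dx.
by rewrite mulrC mulrA ler_wpM2r// expR_ge0.
Qed.

Lemma contraction_cvg0 V e (q : R) : 0 <= q < 1 -> (forall k, 0 <= V k) ->
  (forall k, V k.+1 <= q * V k + e k) -> e @ \oo --> 0 -> V @ \oo --> 0.
Proof.
move=> /andP[q0 q1] V0 VS e0; apply/cvgrPdist_le => eps eps0.
(* Errors below [(1 - q) eps / 2] accumulate to at most [eps / 2] through the geometric series; the
   other half is left for [q ^+ j * V N]. *)
have d0 : 0 < (1 - q) * (eps / 2) by rewrite mulr_gt0 ?divr_gt0// subr_gt0.
have [N _ eN] := (cvgrPdist_le _ _).1 e0 _ d0.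
have VN j : V (j + N)%N <= q ^+ j * V N + eps / 2.
  elim: j => [|j ih]; first by rewrite add0n expr0 mul1r lerDl ltW// divr_gt0.
  rewrite addSn; apply: le_trans (VS _) _.
  have := eN (j + N)%N (leq_addl _ _); rewrite /= sub0r normrN ler_norml.
  move=> /andP[_ h]; have := ler_wpM2l q0 ih; rewrite exprS; lra.
have qj : (fun j => q ^+ j * V N) @ \oo --> 0.
  rewrite -[X in _ --> X](mul0r (V N)); apply: cvgM; last exact: cvg_cst.
  by apply: cvg_expr; rewrite ger0_norm.
have e2 : 0 < eps / 2 by rewrite divr_gt0.
have [J _ qJ] := (cvgrPdist_le _ _).1 qj _ e2.
exists (J + N)%N => // k /= Jk.
rewrite sub0r normrN ger0_norm// -(subnK (leq_trans (leq_addl J N) Jk)).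
apply: le_trans (VN _) _.
have := qJ (k - N)%N; rewrite /= leq_subRL ?(leq_trans (leq_addl J N) Jk)//.
rewrite addnC => /(_ Jk); rewrite sub0r normrN ler_norml; lra.
Qed.

(** With [c > 0], the partial sums of [a k * u k] would eventually grow at least like [c] times
    those of [a], which diverge. *)
Lemma weighted_series_liminf0 a u (c : R) : (forall k, 0 < a k) ->
  series a @ \oo --> +oo -> cvgn (series (fun k => a k * u k)) ->
  (\forall k \near \oo, c <= u k) -> c <= 0.
Proof.
move=> a0 ay cu [N _ uN]; rewrite leNgt; apply/negP => c0.
have [M M0 uM] := cvgn_ubound cu.
pose D := series (fun k => a k * u k) N.
have lb j : c * (series a (j + N)%N - series a N)
            <= series (fun k => a k * u k) (j + N)%N - D.
  elim: j => [|j ih]; first by rewrite add0n !subrr mulr0.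
  rewrite addSn !seriesS.
  have := ler_wpM2l (ltW (a0 (j + N)%N)) (uN (j + N)%N (leq_addl _ _)); lra.
have [K _ aK] := (cvgryPge _).1 ay ((M - D + 1) / c + series a N).
have := aK (K + N)%N (leq_addr _ _); rewrite /= -lerBrDr ler_pdivrMr//.
by have := lb K; have := uM (K + N)%N; lra.
Qed.

(* The increments of [h ^+ 3] are dominated by [a k * h k ^+ 2] and
   [a k ^+ 3], so [h ^+ 3] has a limit, which divergence of [series a]
   forces to be 0. *)
Lemma slowly_varying_cvg0 a h (C : R) :
  (forall k, 0 < a k) -> (forall k, 0 <= h k) -> 0 <= C ->
  (forall k, `|h k.+1 - h k| <= C * a k) ->
  series a @ \oo --> +oo -> cvgn (series (fun k => a k ^+ 3)) ->
  cvgn (series (fun k => a k * h k ^+ 2)) -> h @ \oo --> 0.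
Proof.
move=> a0 h0 C0 hS ay ca3 cah.
have inc k : `|h k.+1 ^+ 3 - h k ^+ 3|
             <= 6 * C * (a k * h k ^+ 2) + 6 * C ^+ 3 * a k ^+ 3.
  (* The second factor is at most [3 (h k + C a k)^2 <= 6 h k ^2 + 6 (C a k)^2], which separates the
     two summable terms. *)
  have -> : h k.+1 ^+ 3 - h k ^+ 3 =
    (h k.+1 - h k) * (h k.+1 ^+ 2 + h k.+1 * h k + h k ^+ 2) by ring.
  rewrite normrM [X in _ * X]ger0_norm; last first.
    by rewrite !addr_ge0 ?sqr_ge0 ?mulr_ge0.
  have Ca : 0 <= C * a k by rewrite mulr_ge0// ltW.
  have hle : h k.+1 <= h k + C * a k by have := hS k; rewrite ler_norml; lra.
  apply: (@le_trans _ _ (C * a k * (3 * (h k + C * a k) ^+ 2))).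
    apply: ler_pM => //; first by rewrite !addr_ge0 ?sqr_ge0 ?mulr_ge0.
    have := h0 k; have := h0 k.+1; nra.
  have -> : 6 * C * (a k * h k ^+ 2) + 6 * C ^+ 3 * a k ^+ 3 =
    C * a k * (6 * h k ^+ 2 + 6 * (C * a k) ^+ 2) by ring.
  rewrite ler_wpM2l//.
  by have := sqr_ge0 (h k - C * a k); lra.
have ch3 : cvgn (fun k => h k ^+ 3).
  have cd : cvgn (series (fun k => h k.+1 ^+ 3 - h k ^+ 3)).
    apply: normed_cvg; apply: (series_le_cvg _ _ inc) => //.
      move=> k; rewrite addr_ge0// !mulr_ge0 ?sqr_ge0 ?exprn_ge0//;
        exact: ltW.
    by apply: series_add_is_cvg; exact: series_scale_is_cvg.
  have -> : (fun k => h k ^+ 3) =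
      series (fun k => h k.+1 ^+ 3 - h k ^+ 3) + cst (h 0%N ^+ 3).
    apply/funext => k; rewrite fctE /series /= telescope_sumr// /cst; lra.
  by apply: is_cvgD => //; exact: is_cvg_cst.
have [l hl] := (cvg_ex _).1 ch3; rewrite /= in hl.
have l0 : l = 0.
  apply/eqP; rewrite eq_le; apply/andP; split; last first.
    by apply: (cvgr_to_ge hl); near=> k; rewrite exprn_ge0.
  rewrite leNgt; apply/negP => lp.
  (* With this [c], [c^3 <= c <= l / 2], so [h k < c] would contradict [h k ^+ 3 >= l / 2]. *)
  pose c := Num.min 1 (l / 2).
  have c0 : 0 < c by rewrite lt_min ltr01 divr_gt0.
  suff : c ^+ 2 <= 0 by rewrite leNgt exprn_gt0.
  apply: (@weighted_series_liminf0 a (fun k => h k ^+ 2) _ a0 ay cah).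
  have l2 : 0 < l / 2 by rewrite divr_gt0.
  have [N _ hN] := (cvgrPdist_le _ _).1 hl _ l2; exists N => // k /= /hN /=.
  rewrite ler_norml => /andP[_ hk].
  rewrite ler_pXn2r ?nnegrE ?(ltW c0)// leNgt; apply/negP => hc.
  have c1 : c <= 1 by rewrite ge_min lexx.
  have cl : c <= l / 2 by rewrite ge_min lexx orbT.
  have : h k ^+ 3 < c ^+ 3 by rewrite ltrXn2r.
  have : c ^+ 3 <= c by rewrite exprS ger_pMr// exprn_ile1// ltW.
  lra.
apply/cvgrPdist_le => e e0; rewrite l0 in hl.
have e3 : 0 < e ^+ 3 by rewrite exprn_gt0.
have [N _ hN] := (cvgrPdist_le _ _).1 hl _ e3; exists N => // k /= /hN /=.
rewrite !sub0r !normrN ger0_norm ?exprn_ge0// ger0_norm//.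
by rewrite ler_pXn2r ?nnegrE ?(ltW e0).
Unshelve. all: by end_near. Qed.

(** The minimum up to [T], weighted by the steps between [S] and [T], is below a tail of the
    convergent series. The default [x0] only gives a value to the minimum over the empty range. *)
Lemma series_mul_bigmin_cvg0 a u (x0 : R) :
  (forall k, 0 < a k) -> (forall k, 0 <= u k) -> 0 <= x0 ->
  series a @ \oo --> +oo -> cvgn (series (fun k => a k * u k)) ->
  (fun T => series a T * \big[Num.min/x0]_(0 <= k < T) u k) @ \oo --> 0.
Proof.
move=> a0 u0 x00 ay cu.
pose m := fun T => \big[Num.min/x0]_(0 <= k < T) u k.
have m0 T : 0 <= m T.
  by rewrite /m; elim/big_ind : _ => // x y x0' y0'; rewrite le_min x0'.
have mu T k : (k < T)%N -> m T <= u k.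
  move=> kT; rewrite /m big_mkord.
  exact: (@bigmin_le _ _ _ x0 (Ordinal kT) (fun i => u (val i))).
have ser0 T : 0 <= series a T.
  by rewrite /series /=; apply: sumr_ge0 => k _; exact: ltW.
have nd : nondecreasing_seq (series (fun k => a k * u k)).
  by apply: nondecreasing_series => k; rewrite mulr_ge0// ltW.
apply/cvgrPdist_le => e e0.
have e2 : 0 < e / 2 by rewrite divr_gt0.
have [S _ tS] := (cvgrPdist_le _ _).1 cu _ e2.
(* Beyond [T0] the whole sum of steps is at most twice its part after [S], so a tail below [e / 2]
   suffices. *)
have [T0 _ hT0] := (cvgryPge _).1 ay (2 * series a S).
exists (maxn S T0) => // T /=; rewrite geq_max => /andP[ST T0T].
rewrite sub0r normrN -/(m T) ger0_norm ?mulr_ge0//.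
have tail j : (j + S <= T)%N ->
    m T * (series a (j + S)%N - series a S) <=
    series (fun k => a k * u k) (j + S)%N - series (fun k => a k * u k) S.
  elim: j => [|j ih] jT; first by rewrite add0n !subrr mulr0.
  rewrite addSn !seriesS.
  have := ler_wpM2l (ltW (a0 (j + S)%N)) (mu _ _ jT).
  have := ih (ltnW jT); lra.
have := tail (T - S)%N; rewrite subnK// => /(_ (leqnn _)).
have := tS S (leqnn _) => /=; rewrite ler_norml => /andP[_ hS].
have := nondecreasing_cvgn_le nd cu T.
have := ler_wpM2l (m0 T) (hT0 T T0T); rewrite /=; lra.
Qed.

(** Convexity of the square, with [r y + b] read as the mean of [y] and [b / (1 - r)] with weights
    [r] and [1 - r]. *)
Lemma sqr_convex_le (r x y b : R) : 0 <= r < 1 -> 0 <= x ->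
  0 <= y -> 0 <= b -> x <= r * y + b -> x ^+ 2 <= r * y ^+ 2 + b ^+ 2 / (1 - r).
Proof.
move=> /andP[r0 r1] x0 y0 b0 xle.
apply: (@le_trans _ _ ((r * y + b) ^+ 2)).
  by rewrite ler_pXn2r ?nnegrE// addr_ge0// mulr_ge0.
rewrite -subr_ge0.
have -> : r * y ^+ 2 + b ^+ 2 / (1 - r) - (r * y + b) ^+ 2 =
    r / (1 - r) * ((1 - r) * y - b) ^+ 2.
  by field; rewrite gt_eqF// subr_gt0.
by rewrite mulr_ge0 ?sqr_ge0// divr_ge0// subr_ge0 ltW.
Qed.

Lemma cube_cvg0 a : (forall k, 0 <= a k) ->
  (fun k => a k ^+ 3) @ \oo --> 0 -> a @ \oo --> 0.
Proof.
move=> a0 a3; apply/cvgrPdist_le => e e0.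
have e3 : 0 < e ^+ 3 by rewrite exprn_gt0.
have [N _ hN] := (cvgrPdist_le _ _).1 a3 _ e3; exists N => // k /= /hN /=.
rewrite !sub0r !normrN !ger0_norm ?exprn_ge0//.
by rewrite ler_pXn2r ?nnegrE ?(ltW e0).
Qed.

Lemma series_shift u N :
  series (fun k => u (k + N)%N) = fun k => series u (k + N)%N - series u N.
Proof.
apply/funext => k; elim: k => [|k ih]; first by rewrite add0n subrr /series /= big_geq.
by rewrite seriesS ih addSn [in RHS]seriesS /=; lra.
Qed.

Lemma is_cvg_series_shift u N :
  cvgn (series (fun k => u (k + N)%N)) <-> cvgn (series u).
Proof.
rewrite series_shift; split=> /cvg_ex[/= l ul]; apply/cvg_ex.
  exists (l + series u N); rewrite -(cvg_shiftn N).
  have -> : [sequence series u (k + N)%N]_k =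
      (fun k => series u (k + N)%N - series u N + series u N).
    by apply/funext => k; rewrite /= subrK.
  by apply: cvgD => //; exact: cvg_cst.
exists (l - series u N); apply: cvgB; last exact: cvg_cst.
by rewrite (cvg_shiftn N).
Qed.

Lemma series_shift_cvgy u N : series u @ \oo --> +oo ->
  series (fun k => u (k + N)%N) @ \oo --> +oo.
Proof.
move=> uy; rewrite series_shift; apply/cvgryPge => B.
have [K _ uK] := (cvgryPge _).1 uy (B + series u N).
by exists K => // k /= Kk; rewrite lerBrDr uK//= (leq_trans Kk)// leq_addr.
Qed.

(** * Lyapunov analysis of the coupled recursions *)

Section Lyapunov.
Variables (a phi V G h : R ^nat) (C c0 q : R).
Hypotheses (C0 : 0 < C) (c00 : 0 < c0) (q01 : 0 <= q < 1).
Hypotheses (a0 : forall k, 0 < a k) (aS : forall k, a k.+1 <= a k).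
Hypotheses (phi0 : forall k, 0 <= phi k) (V0 : forall k, 0 <= V k).
Hypotheses (G0 : forall k, 0 <= G k) (h0 : forall k, 0 <= h k).
Hypothesis asmall : forall k, C * a k <= (1 - q) / 2.
Hypotheses (ay : series a @ \oo --> +oo)
           (ca3 : cvgn (series (fun k => a k ^+ 3))).
Hypothesis VS : forall k, V k.+1 <= q * V k + C * a k * (V k + G k).
Hypothesis phiS : forall k,
  phi k.+1 <= phi k - c0 * (a k * h k ^+ 2) + C * a k * (V k + a k * G k) ^+ 2.
Hypothesis Gphi : forall k, G k ^+ 2 <= C * phi k.
Hypothesis hS : forall k, `|h k.+1 - h k| <= C * a k * (V k + G k).

(** [r] is the contraction factor left once [asmall] absorbs [C a V] into [q V]. The choice of [c]
    gives [c (1 - r) = 2 C + 1]: contraction of [c a V^2] pays the [2 C a V^2] produced by the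
    descent inequality and leaves [a V^2] to spare. [K] collects the coefficients of [a^3 phi]. *)
Let r := (1 + q) / 2.
Let c := (2 * C + 1) / (1 - r).
Let K := 2 * C ^+ 2 + c * C ^+ 3 / (1 - r).
Let P k := phi k + c * a k * V k ^+ 2.

Let r01 : 0 <= r < 1.
Proof. by rewrite /r; move: q01 => /andP[]; lra. Qed.

Let rp : 0 < 1 - r.
Proof. by move: r01 => /andP[]; lra. Qed.

Let cp : 0 < c.
Proof. by rewrite /c divr_gt0// addr_gt0// mulr_gt0. Qed.

Let cr : c * (1 - r) = 2 * C + 1.
Proof. by rewrite /c divfK// gt_eqF. Qed.

Let Kp : 0 <= K.
Proof.
have := exprn_ge0 2 (ltW C0).
have := divr_ge0 (mulr_ge0 (ltW cp) (exprn_ge0 3 (ltW C0))) (ltW rp).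
rewrite /K; lra.
Qed.

Let P0 k : 0 <= P k.
Proof.
by rewrite /P addr_ge0// mulr_ge0 ?sqr_ge0// mulr_ge0 ?(ltW (a0 _))// ltW.
Qed.

Let V_contracts k : V k.+1 <= r * V k + C * a k * G k.
Proof.
have := ler_wpM2r (V0 k) (asmall k); have := VS k; rewrite /r; lra.
Qed.

Lemma lyapunov_decrease k :
  P k.+1 <= P k + K * a k ^+ 3 * phi k - a k * (c0 * h k ^+ 2 + V k ^+ 2).
Proof.
have ap := a0 k.
have CaG : 0 <= C * a k * G k by rewrite !mulr_ge0// ltW.
have V2 := sqr_convex_le r01 (V0 k.+1) (V0 k) CaG (V_contracts k).
have G2 : (C * a k * G k) ^+ 2 / (1 - r) <= C ^+ 3 * a k ^+ 2 * phi k / (1 - r).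
  rewrite ler_pM2r ?invr_gt0// exprMn.
  have -> : C ^+ 3 * a k ^+ 2 * phi k = (C * a k) ^+ 2 * (C * phi k) by ring.
  by rewrite ler_wpM2l ?sqr_ge0.
(* Monotonicity of the steps replaces the weight [a k.+1] by [a k]. *)
have PV : c * a k.+1 * V k.+1 ^+ 2 <=
    c * a k * (r * V k ^+ 2 + C ^+ 3 * a k ^+ 2 * phi k / (1 - r)).
  apply: ler_pM; [|exact: sqr_ge0| |].
  - exact: mulr_ge0 (ltW cp) (ltW (a0 _)).
  - exact: ler_wpM2l (ltW cp) _ _ (aS k).
  by apply: le_trans V2 _; rewrite lerD2l.
have PHI : C * a k * (V k + a k * G k) ^+ 2 <=
    2 * C * a k * V k ^+ 2 + 2 * C ^+ 2 * a k ^+ 3 * phi k.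
  have -> : 2 * C * a k * V k ^+ 2 + 2 * C ^+ 2 * a k ^+ 3 * phi k =
    C * a k * (2 * V k ^+ 2 + 2 * a k ^+ 2 * (C * phi k)) by ring.
  rewrite ler_wpM2l ?mulr_ge0 ?(ltW C0) ?(ltW ap)//.
  have := ler_wpM2l (sqr_ge0 (a k)) (Gphi k).
  have := sqr_ge0 (V k - a k * G k); lra.
have E : c * a k * (r * V k ^+ 2 + C ^+ 3 * a k ^+ 2 * phi k / (1 - r)) =
    c * a k * V k ^+ 2 - (c * (1 - r)) * (a k * V k ^+ 2)
    + c * C ^+ 3 / (1 - r) * a k ^+ 3 * phi k.
  by field; rewrite gt_eqF.
rewrite E cr in PV.
rewrite /P /K; have := phiS k; lra.
Qed.

(** Since [phi <= P], the recursion is [P k.+1 <= (1 + K a k ^3) P k] with summable [a k ^3], so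
    Gronwall applies; the added 1 makes the bound positive. *)
Lemma lyapunov_bounded : exists2 B, 0 < B & forall k, P k <= B.
Proof.
have [M M0 aM] := cvgn_ubound (series_scale_is_cvg (c := K) ca3).
exists (P 0%N * expR M + 1); first by rewrite ltr_wpDl ?mulr_ge0 ?expR_ge0.
move=> k; rewrite ler_wpDr//.
apply: le_trans (@discrete_gronwall P (fun k => K * a k ^+ 3) P0 _ k) _.
  move=> {}k; apply: le_trans (lyapunov_decrease k) _.
  have h1 : 0 <= a k * (c0 * h k ^+ 2 + V k ^+ 2).
    by rewrite mulr_ge0 ?(ltW (a0 _))// addr_ge0 ?sqr_ge0// mulr_ge0 ?sqr_ge0// ltW.
  have : K * a k ^+ 3 * phi k <= K * a k ^+ 3 * P k.
    rewrite ler_wpM2l//; first by rewrite mulr_ge0// exprn_ge0// ltW.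
    rewrite /P lerDl mulr_ge0 ?sqr_ge0// mulr_ge0 ?(ltW (a0 _))// ltW//.
  lra.
by rewrite ler_wpM2l// ler_expR.
Qed.

(** Boundedness of [P] turns the multiplicative error into the summable additive error [K B a^3], so
    [P] converges and the decrease terms are summable. *)
Lemma lyapunov_cvg :
  [/\ cvgn phi, V @ \oo --> 0, h @ \oo --> 0,
      cvgn (series (fun k => a k * h k ^+ 2)) &
      cvgn (series (fun k => a k * V k ^+ 2))].
Proof.
have [B B0 PB] := lyapunov_bounded.
have a_cvg0 : a @ \oo --> 0.
  by apply: cube_cvg0 (cvg_series_cvg_0 ca3) => k; exact: ltW.
have phiB k : phi k <= B.
  apply: le_trans (PB k); rewrite /P lerDl mulr_ge0 ?sqr_ge0//.
  by rewrite mulr_ge0 ?(ltW (a0 _))// ltW.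
have w0 k : 0 <= a k * (c0 * h k ^+ 2 + V k ^+ 2).
  by rewrite mulr_ge0 ?(ltW (a0 _))// addr_ge0 ?sqr_ge0// mulr_ge0 ?sqr_ge0// ltW.
have e0 k : 0 <= K * B * a k ^+ 3.
  exact: mulr_ge0 (mulr_ge0 Kp (ltW B0)) (exprn_ge0 3 (ltW (a0 k))).
have PS k : P k.+1 <= P k + K * B * a k ^+ 3 - a k * (c0 * h k ^+ 2 + V k ^+ 2).
  apply: le_trans (lyapunov_decrease k) _; rewrite lerD2r lerD2l mulrAC.
  by rewrite ler_wpM2r ?exprn_ge0 ?(ltW (a0 _))// ler_wpM2l.
have [cP cw] := quasi_decreasing_is_cvg P0 w0 e0 (series_scale_is_cvg ca3) PS.
have cah : cvgn (series (fun k => a k * h k ^+ 2)).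
  apply: (series_le_cvg _ _ _ (series_scale_is_cvg (c := c0^-1) cw)) => k.
  - by rewrite mulr_ge0 ?sqr_ge0// ltW.
  - by rewrite mulr_ge0// invr_ge0 ltW.
  - rewrite ler_pdivlMl// mulrCA ler_wpM2l ?(ltW (a0 _))//.
    by rewrite lerDl sqr_ge0.
have caV : cvgn (series (fun k => a k * V k ^+ 2)).
  apply: (series_le_cvg _ w0 _ cw) => k.
    by rewrite mulr_ge0 ?sqr_ge0// ltW.
  by rewrite ler_wpM2l ?(ltW (a0 _))// lerDr mulr_ge0 ?sqr_ge0// ltW.
(* Uses [2 G <= G^2 + 1] and the bound [G^2 <= C phi <= C B]. *)
have GB k : G k <= 1 + C * B.
  have := Gphi k; have := ler_wpM2l (ltW C0) (phiB k).
  by have := sqr_ge0 (G k - 1); have := sqr_ge0 (G k); lra.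
have CB : 0 <= C * B by rewrite mulr_ge0// ltW.
have V_cvg0 : V @ \oo --> 0.
  apply: (contraction_cvg0 r01 V0 (e := fun k => a k * (C * (1 + C * B)))).
    move=> k; apply: le_trans (V_contracts k) _; rewrite lerD2l.
    by rewrite [C * a k]mulrC -mulrA !ler_wpM2l ?(ltW C0) ?(ltW (a0 _)).
  rewrite -[X in _ --> X](mul0r (C * (1 + C * B))).
  by apply: cvgM => //; exact: cvg_cst.
have [M M0 VM] := cvgn_ubound (cvgP _ V_cvg0).
split=> //.
(* [phi] inherits the limit of [P] because [c a V^2] tends to 0. *)
- have -> : phi = P - (fun k => c * (a k * V k ^+ 2)).
    by apply/funext => k; rewrite !fctE /P; lra.
  apply: is_cvgB => //; apply: (cvgP (c * (0 * 0 ^+ 2))).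
  apply: cvgM; first exact: cvg_cst.
  by apply: cvgM => //; exact: cvgM.
- apply: (@slowly_varying_cvg0 a h (C * (M + (1 + C * B)))) => //.
    by rewrite mulr_ge0 ?addr_ge0// ltW.
  move=> k; apply: le_trans (hS k) _; rewrite mulrAC.
  rewrite ler_wpM2r ?(ltW (a0 _))// ler_wpM2l ?(ltW C0)//.
  exact: lerD.
Qed.

End Lyapunov.

(** The steps tend to 0 because their cubes are summable, so [asmall] holds from some index [N] on;
    all conclusions are insensitive to a shift by [N]. *)
Lemma lyapunov_cvg_eventually a phi V G h (C c0 q : R) :
  0 < C -> 0 < c0 -> 0 <= q < 1 ->
  (forall k, 0 < a k) -> (forall k, a k.+1 <= a k) ->
  (forall k, 0 <= phi k) -> (forall k, 0 <= V k) ->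
  (forall k, 0 <= G k) -> (forall k, 0 <= h k) ->
  series a @ \oo --> +oo -> cvgn (series (fun k => a k ^+ 3)) ->
  (forall k, V k.+1 <= q * V k + C * a k * (V k + G k)) ->
  (forall k, phi k.+1 <=
     phi k - c0 * (a k * h k ^+ 2) + C * a k * (V k + a k * G k) ^+ 2) ->
  (forall k, G k ^+ 2 <= C * phi k) ->
  (forall k, `|h k.+1 - h k| <= C * a k * (V k + G k)) ->
  [/\ cvgn phi, V @ \oo --> 0, h @ \oo --> 0,
      cvgn (series (fun k => a k * h k ^+ 2)) &
      cvgn (series (fun k => a k * V k ^+ 2))].
Proof.
move=> C0 c00 /andP[q0 q1] a0 aS phi0 V0 G0 h0 ay ca3 VS phiS Gphi hS.
have a_cvg0 : a @ \oo --> 0.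
  by apply: cube_cvg0 (cvg_series_cvg_0 ca3) => k; exact: ltW.
have s0 : 0 < (1 - q) / 2 / C by rewrite !divr_gt0// subr_gt0.
have [N _ aN] := (cvgrPdist_le _ _).1 a_cvg0 _ s0.
have small k : C * a (k + N)%N <= (1 - q) / 2.
  have := aN (k + N)%N (leq_addl _ _).
  by rewrite /= sub0r normrN gtr0_norm// ler_pdivlMr// mulrC.
have q01 : 0 <= q < 1 by rewrite q0.
have [cphi cV ch cah caV] := lyapunov_cvg C0 c00 q01 (fun k => a0 (k + N)%N)
  (fun k => aS (k + N)%N) (fun k => phi0 (k + N)%N) (fun k => V0 (k + N)%N)
  (fun k => G0 (k + N)%N) (fun k => h0 (k + N)%N) small (series_shift_cvgy N ay)
  ((is_cvg_series_shift (fun k => a k ^+ 3) N).2 ca3)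
  (fun k => VS (k + N)%N) (fun k => phiS (k + N)%N) (fun k => Gphi (k + N)%N)
  (fun k => hS (k + N)%N).
split.
- move: cphi => /cvg_ex[l hl]; apply/cvg_ex; exists l.
  by rewrite -(cvg_shiftn N).
- by rewrite -(cvg_shiftn N).
- by rewrite -(cvg_shiftn N).
- exact/(is_cvg_series_shift (fun k => a k * h k ^+ 2) N).
- exact/(is_cvg_series_shift (fun k => a k * V k ^+ 2) N).
Qed.

End RealSequences.

(** * One epoch of the iteration *)

Section Epoch.
Context {R : realType} {d : nat}.
Variables (n b : nat) (F : nat -> 'rV[R]_d -> R) (L beta lambda A : R).
Hypotheses (n0 : (0 < n)%N) (b0 : (0 < b)%N) (bn : (b %| n)%N).
Hypothesis dF : forall i, (i < n)%N -> forall z, differentiable (F i) z.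
Hypothesis L0 : 0 < L.
Hypothesis lF : forall i, (i < n)%N -> lipschitz_grad L (F i).
Hypotheses (beta0 : 0 <= beta) (beta1 : beta < 1).
Hypotheses (lambda0 : 0 <= lambda) (lambdab : lambda <= beta / (1 - beta)).
Hypothesis A0 : 0 < A.

Let m := (n %/ b)%N.
Let f := favg n F.
Let C0 := (1 - beta)^-1.

Let mb : (m * b = n)%N. Proof. exact: divnK. Qed.

Let m0 : (0 < m)%N. Proof. by rewrite divn_gt0// dvdn_leq. Qed.

(** The [m] consecutive batches tile the permutation, so the full gradient sum appears whatever the
    order, and [n / b = m]. *)
Lemma sum_batch_dir pk u : perm_eq pk (iota 0 n) ->
  \sum_(i < m) batch_dir F b pk i.+1 u = m%:R *: grad f u.
Proof.
move=> pkn; rewrite grad_favg// -scaler_sumr scalerA.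
have -> : m%:R / n%:R = b%:R^-1 :> R.
  by rewrite -mb natrM invfM mulVKf// pnatr_eq0 -lt0n.
congr (_ *: _).
have sz : size pk = n by rewrite (perm_size pkn) size_iota.
transitivity (\sum_(0 <= k < m * b) grad (F (nth 0%N pk k)) u).
  rewrite big_nat_mul big_mkord; apply: eq_bigr => i _ /=.
  rewrite -[X in index_iota X _]add0n big_addn mulSn addnK big_mkord.
  by apply: eq_bigr => j _; rewrite addnC.
rewrite mb -sz -(big_nth 0%N predT (fun j => grad (F j) u)).
by rewrite (perm_big _ pkn) /= sz -{1}[n]subn0 big_mkord.
Qed.

Let nth_pk pk i j : perm_eq pk (iota 0 n) -> (i < m)%N -> (j < b)%N ->
  (nth 0%N pk (i * b + j) < n)%N.
Proof.
move=> pkn im jb.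
have ijn : (i * b + j < n)%N.
  rewrite -mb; apply: (@leq_trans (i * b + b)); first by rewrite ltn_add2l.
  by rewrite -mulSnr leq_mul2r im orbT.
have : nth 0%N pk (i * b + j) \in iota 0 n.
  by rewrite -(perm_mem pkn) mem_nth// (perm_size pkn) size_iota.
by rewrite mem_iota.
Qed.

Lemma batch_dir_lipschitz pk i u w : perm_eq pk (iota 0 n) -> (i < m)%N ->
  enorm (batch_dir F b pk i.+1 u - batch_dir F b pk i.+1 w) <= L * enorm (u - w).
Proof.
move=> pkn im; rewrite /batch_dir -scalerBr -sumrB enormZ.
rewrite ger0_norm ?invr_ge0// ler_pdivrMl ?ltr0n//.
apply: le_trans (ler_enorm_sum _ _ _) _.
rewrite [b%:R * _]mulr_natl -[b in leRHS]card_ord -sumr_const.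
by apply: ler_sum => j _; exact: lF (nth_pk pkn im (ltn_ord j)) _ _.
Qed.

Lemma batch_dir_bound pk i u (G : R) : perm_eq pk (iota 0 n) -> (i < m)%N ->
  (forall j, (j < n)%N -> enorm (grad (F j) u) <= G) ->
  enorm (batch_dir F b pk i.+1 u) <= G.
Proof.
move=> pkn im uG; rewrite /batch_dir enormZ.
rewrite ger0_norm ?invr_ge0// ler_pdivrMl ?ltr0n//.
apply: le_trans (ler_enorm_sum _ _ _) _.
rewrite mulr_natl -[b in leRHS]card_ord -sumr_const.
by apply: ler_sum => j _; exact: uG (nth_pk pkn im (ltn_ord j)).
Qed.

Let C01 : 1 <= C0.
Proof. by rewrite invf_ge1 ?subr_gt0// gerBl. Qed.

Let C0p : 0 < C0.
Proof. exact: lt_le_trans ltr01 C01. Qed.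

(* Velocity [w] and proxy [p] after [i] steps of an epoch; [w] contracts with
   factor [beta], while [p] performs momentum-free steps of length
   [alpha / (1 - beta)]. *)
Section Trajectory.
Variables (alpha : R) (pk : seq nat) (y : nat -> 'rV[R]_d) (G : R).
Hypotheses (alpha0 : 0 < alpha) (alphaA : alpha <= A).
Hypothesis pkn : perm_eq pk (iota 0 n).
Let w i := y i.+1 - y i.
Let yh i := y i.+1 + lambda *: w i.
Let p i := y i.+1 + (beta / (1 - beta)) *: w i.
(** Indices are shifted by one: [dir i] is the direction of step [i.+1], which starts from [y i] and
    [y i.+1]. Thus [p 0] and [p m] are the proxies at the two ends of the epoch. *)
Let dir i := batch_dir F b pk i.+1 (yh i).
Hypothesis yS : forall i, (i < m)%N ->
  y i.+2 = y i.+1 - alpha *: dir i + beta *: w i.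
Hypotheses (G0 : 0 <= G)
           (gG : forall j, (j < n)%N -> enorm (grad (F j) (p 0%N)) <= G).

Lemma velocityS i : (i < m)%N -> w i.+1 = beta *: w i - alpha *: dir i.
Proof. by move=> im; rewrite {1}/w yS// addrAC [_ - y _]addrAC subrr add0r addrC. Qed.

(** The weight [c = beta / (1 - beta)] solves [beta (1 + c) = c], so the velocity term reproduces
    itself, and [1 + c = C0] scales the direction. *)
Lemma proxyS i : (i < m)%N -> p i.+1 = p i - (alpha * C0) *: dir i.
Proof.
move=> im; rewrite /p velocityS// yS//; move: (dir i) (w i) => D w'.
by apply/rowP => j; rewrite !mxE /C0; field; rewrite gt_eqF// subr_gt0.
Qed.

(** Growth factor per step of [|w i| + |p i - p 0|]. Both terms gain at most [alpha C0 |dir i|],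
    hence the factors 2; the Lipschitz part of [dir] gives [A L C0^2], and [alpha G], included in
    [W], gives [C0]. *)
Let kappa := 1 + 2 * A * L * C0 ^+ 2 + 2 * C0.
Let W := enorm (w 0%N) + alpha * G.
Let M := kappa ^+ m.

Let kappa1 : 1 <= kappa.
Proof.
have : 0 <= A * L * C0 ^+ 2 by rewrite !mulr_ge0 ?sqr_ge0// ltW.
by move: C01; rewrite /kappa; lra.
Qed.

(** The extrapolated point differs from [p i] by a multiple of [w i] whose coefficient lies between
    [- beta / (1 - beta)] and 0. *)
Lemma yhat_proxy i : enorm (yh i - p 0%N) <=
  C0 * (enorm (w i) + enorm (p i - p 0%N)).
Proof.
have -> : yh i - p 0%N = (lambda - beta / (1 - beta)) *: w i + (p i - p 0%N).
  by rewrite /yh /p; apply/rowP => j; rewrite !mxE; ring.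
apply: le_trans (ler_enormD _ _) _; rewrite enormZ mulrDr lerD//.
  rewrite ler_wpM2r ?enorm_ge0// ler0_norm ?subr_le0// opprB.
  have : beta / (1 - beta) <= C0.
    by rewrite ler_piMl ?ltW// invr_gt0 subr_gt0.
  by move: lambda0; lra.
by rewrite ler_peMl ?enorm_ge0.
Qed.

Lemma dir_le i : (i < m)%N -> enorm (dir i) <= L * enorm (yh i - p 0%N) + G.
Proof.
move=> im; rewrite -(subrK (batch_dir F b pk i.+1 (p 0%N)) (dir i)).
apply: le_trans (ler_enormD _ _) _; apply: lerD.
  exact: batch_dir_lipschitz.
exact: batch_dir_bound.
Qed.

Lemma drift_pow i : (i <= m)%N ->
  enorm (w i) + enorm (p i - p 0%N) <= kappa ^+ i * W.
Proof.
have W0 : 0 <= W by rewrite addr_ge0 ?enorm_ge0// mulr_ge0// ltW.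
elim: i => [_|i ih im].
  by rewrite expr0 mul1r subrr enorm0 lerD2l mulr_ge0// ltW.
set X := enorm (w i) + enorm (p i - p 0%N) in ih *.
have ihX := ih (ltnW im).
have X0 : 0 <= X by rewrite addr_ge0 ?enorm_ge0.
have dX : enorm (dir i) <= L * C0 * X + G.
  apply: le_trans (dir_le im) _; rewrite lerD2r -mulrA ler_pM2l//.
  exact: yhat_proxy.
have wS : enorm (w i.+1) <= enorm (w i) + alpha * C0 * enorm (dir i).
  rewrite velocityS//; apply: le_trans (ler_enormB _ _) _.
  rewrite (enormZ beta) (enormZ alpha) (ger0_norm beta0) (gtr0_norm alpha0) lerD//.
    by rewrite ler_piMl ?enorm_ge0// ltW.
  by rewrite ler_wpM2r ?enorm_ge0// ler_peMr// ltW.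
have pS : enorm (p i.+1 - p 0%N) <= enorm (p i - p 0%N) + alpha * C0 * enorm (dir i).
  rewrite proxyS// addrAC; apply: le_trans (ler_enormB _ _) _.
  by rewrite enormZ gtr0_norm// mulr_gt0.
have aC : 0 <= alpha * C0 by rewrite mulr_ge0// ltW.
have h1 := ler_wpM2l aC dX.
have h2 : alpha * (L * C0 ^+ 2 * X) <= A * (L * C0 ^+ 2 * X).
  by rewrite ler_wpM2r// !mulr_ge0 ?sqr_ge0// ltW.
(* The inhomogeneous term is absorbed in [W], which makes the recursion purely multiplicative. *)
have h3 : alpha * G <= kappa ^+ i * W.
  apply: (@le_trans _ _ W); first by rewrite lerDr enorm_ge0.
  by rewrite ler_peMl// exprn_ege1.
have h4 : C0 * (alpha * G) <= C0 * (kappa ^+ i * W) by rewrite ler_pM2l.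
have h5 : (1 + 2 * A * L * C0 ^+ 2) * X <= (1 + 2 * A * L * C0 ^+ 2) * (kappa ^+ i * W).
  rewrite ler_wpM2l// addr_ge0// !mulr_ge0 ?sqr_ge0// ltW//.
rewrite exprS -mulrA {1}/kappa; rewrite /X in h1 h2 h5 *; lra.
Qed.

Let E := C0 * M * W.

Lemma yhat_le i : (i < m)%N -> enorm (yh i - p 0%N) <= E.
Proof.
move=> im; apply: le_trans (yhat_proxy i) _; rewrite /E -mulrA ler_pM2l//.
apply: le_trans (drift_pow (ltnW im)) _.
rewrite ler_wpM2r//; first by rewrite addr_ge0 ?enorm_ge0// mulr_ge0// ltW.
by rewrite ler_weXn2l// ltnW.
Qed.

Lemma dir_bound i : (i < m)%N -> enorm (dir i) <= L * E + G.
Proof.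
by move=> im; apply: le_trans (dir_le im) _; rewrite lerD2r ler_pM2l// yhat_le.
Qed.

(** The factor [beta ^+ m] is kept exact, since it drives the contraction between epochs; the
    injected errors are simply added, using [beta <= 1]. *)
Lemma velocity_end :
  enorm (w m) <= beta ^+ m * enorm (w 0%N) + m%:R * alpha * (L * E + G).
Proof.
have LEG : 0 <= L * E + G by apply: le_trans (dir_bound m0); exact: enorm_ge0.
suff : forall i, (i <= m)%N ->
    enorm (w i) <= beta ^+ i * enorm (w 0%N) + i%:R * alpha * (L * E + G) by exact.
elim=> [_|i ih im]; first by rewrite expr0 mul1r !mul0r addr0.
rewrite velocityS//; apply: le_trans (ler_enormB _ _) _.
rewrite (enormZ beta) (enormZ alpha) (ger0_norm beta0) (gtr0_norm alpha0).
have h1 := ler_wpM2l beta0 (ih (ltnW im)).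
have h2 := ler_wpM2l (ltW alpha0) (dir_bound im).
have h3 : beta * (i%:R * alpha * (L * E + G)) <= i%:R * alpha * (L * E + G).
  by rewrite ler_piMl ?(ltW beta1)// !mulr_ge0// ltW.
rewrite exprS -natr1; lra.
Qed.

Lemma proxy_end : p m = p 0%N - (alpha * C0) *: \sum_(i < m) dir i.
Proof.
suff : forall k, (k <= m)%N ->
  p k = p 0%N - (alpha * C0) *: \sum_(i < k) dir i by exact.
elim=> [_|k ih km]; first by rewrite big_ord0 scaler0 subr0.
by rewrite proxyS// ih ?(ltnW km)// big_ord_recr /= scalerDr opprD addrA.
Qed.

Lemma proxy_step : enorm (p m - p 0%N) <= m%:R * alpha * C0 * (L * E + G).
Proof.
rewrite proxy_end addrAC subrr add0r enormN enormZ gtr0_norm ?mulr_gt0//.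
rewrite -[m%:R * _ * _]mulrA (mulrC m%:R) -(mulrA (alpha * C0)) ler_pM2l ?mulr_gt0//.
apply: le_trans (ler_enorm_sum _ _ _) _.
rewrite mulr_natl -[m in leRHS]card_ord -sumr_const.
by apply: ler_sum => i _; exact: dir_bound.
Qed.

(** The epoch is an inexact gradient step [- tau (g + e)] with [|e| <= L E]. As [L tau <= 1], the
    descent inequality leaves [- tau <g, g + e> + tau / 2 |g + e|^2 = - tau / 2 |g|^2 + tau / 2
    |e|^2]. *)
Lemma proxy_descent : L * (m%:R * alpha * C0) <= 1 ->
  f (p m) <= f (p 0%N) - m%:R * C0 / 2 * (alpha * enorm (grad f (p 0%N)) ^+ 2)
             + m%:R * C0 / 2 * alpha * (L * E) ^+ 2.
Proof.
set tau := m%:R * alpha * C0 => Ltau.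
have mp : 0 < m%:R :> R by rewrite ltr0n.
have tau0 : 0 < tau by rewrite !mulr_gt0.
set g := grad f (p 0%N).
pose e := m%:R^-1 *: \sum_(i < m) dir i - g.
have eE : enorm e <= L * E.
  (* At the fixed point [p 0] the batches average exactly to [g], so only the drift of the
     evaluation points remains. *)
  have -> : e = m%:R^-1 *: \sum_(i < m) (dir i - batch_dir F b pk i.+1 (p 0%N)).
    rewrite /e sumrB; move: (\sum_(i < m) dir i) => S.
    rewrite (sum_batch_dir (p 0%N) pkn) -/g scalerBr (scalerA m%:R^-1 m%:R).
    by rewrite mulVf ?gt_eqF// scale1r.
  rewrite enormZ gtr0_norm ?invr_gt0// ler_pdivrMl//.
  apply: le_trans (ler_enorm_sum _ _ _) _.
  rewrite mulr_natl -[m in leRHS]card_ord -sumr_const.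
  apply: ler_sum => i _; apply: le_trans (batch_dir_lipschitz _ _ pkn _) _ => //.
  by rewrite ler_pM2l// yhat_le.
have stepE : p m - p 0%N = - tau *: (g + e).
  rewrite proxy_end addrAC subrr add0r /e [g + _]addrC subrK scalerA -scaleNr.
  by congr (_ *: _); rewrite /tau; field; rewrite gt_eqF.
have df u : differentiable f u by exact: differentiable_favg.
have := smooth_descent df (lipschitz_grad_favg n0 dF lF) (p m) (p 0%N).
rewrite -/f -/g stepE dotvZr enormZ normrN (gtr0_norm tau0) exprMn.
rewrite enormD_sqr dotvDr -enorm_sqr => H.
apply: le_trans H _.
have e2 : enorm e ^+ 2 <= (L * E) ^+ 2.
  by rewrite ler_pXn2r ?nnegrE ?enorm_ge0// (le_trans (enorm_ge0 e)).
have S0 : 0 <= enorm g ^+ 2 + 2 * dotv g e + enorm e ^+ 2.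
  by rewrite -enormD_sqr sqr_ge0.
have h1 : tau * (L * tau) * (enorm g ^+ 2 + 2 * dotv g e + enorm e ^+ 2)
    <= tau * (enorm g ^+ 2 + 2 * dotv g e + enorm e ^+ 2).
  by rewrite ler_wpM2r// ler_piMr// ltW.
have h2 := ler_wpM2l (ltW tau0) e2.
have -> : m%:R * C0 / 2 * (alpha * enorm g ^+ 2) = tau / 2 * enorm g ^+ 2.
  by rewrite /tau; field.
have -> : m%:R * C0 / 2 * alpha * (L * E) ^+ 2 = tau / 2 * (L * E) ^+ 2.
  by rewrite /tau; field.
move: h1 h2; set D := dotv g e; set Q := (L * E) ^+ 2; lra.
Qed.

End Trajectory.

(** * Proxies and epoch bounds with uniform constants *)

Definition proxy (u ut : 'rV[R]_d) : 'rV[R]_d :=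
  (1 - beta)^-1 *: u - (beta / (1 - beta)) *: ut.

(** Extrapolation form, matching [p] along a trajectory and exhibiting the distance from [x] to [z]
    as a multiple of [|x - xt|]. *)
Lemma proxyE u ut : proxy u ut = u + (beta / (1 - beta)) *: (u - ut).
Proof.
by apply/rowP => j; rewrite !mxE; field; rewrite gt_eqF// subr_gt0.
Qed.

Lemma favg_gap (fbar : R) u :
  n%:R * (f u - fbar) = \sum_(i < n) (F i u - fbar).
Proof.
rewrite sumrB sumr_const card_ord mulrBr (mulr_natl fbar); congr (_ - _).
by rewrite /f /favg mulVKf// pnatr_eq0 -lt0n.
Qed.

(** All gaps [F i u - fbar] are nonnegative, so each one is at most their sum [n (f u - fbar)]. *)
Lemma grad_component_le (fbar : R) u :
  (forall i, (i < n)%N -> forall v, fbar <= F i v) -> forall j, (j < n)%N ->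
  enorm (grad (F j) u) <= Num.sqrt (2 * L * n%:R * (f u - fbar)).
Proof.
move=> Fb j jn; rewrite -mulrA favg_gap.
have gap0 (i : 'I_n) : 0 <= F i u - fbar by rewrite subr_ge0 Fb.
have S0 : 0 <= \sum_(i < n) (F i u - fbar) by exact: sumr_ge0.
rewrite -(@ler_pXn2r _ 2)// ?nnegrE ?enorm_ge0 ?sqrtr_ge0//.
rewrite [leRHS]sqr_sqrtr; last by rewrite !mulr_ge0// ltW.
apply: le_trans (grad_sqr_le L0 (dF jn) (lF jn) (Fb _ jn) u) _.
rewrite ler_pM2l ?mulr_gt0// (bigD1 (Ordinal jn))//= lerDl.
exact: sumr_ge0.
Qed.

(** Supplies the three recursions of the Lyapunov analysis; [C] is chosen before the step size, the
    permutation and the trajectory, so one constant serves all epochs. *)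
Lemma epoch_bounds (fbar : R) :
  (forall i, (i < n)%N -> forall u, fbar <= F i u) ->
  L * (m%:R * A * C0) <= 1 ->
  exists2 C, 0 < C & forall (alpha : R) pk (y : nat -> 'rV[R]_d),
    0 < alpha -> alpha <= A -> perm_eq pk (iota 0 n) ->
    (forall i, (1 <= i <= m)%N ->
       let yhat := y i + lambda *: (y i - y i.-1) in
       y i.+1 = y i - alpha *: batch_dir F b pk i yhat
                + beta *: (y i - y i.-1)) ->
    let z0 := proxy (y 1%N) (y 0%N) in
    let z1 := proxy (y m.+1) (y m) in
    let V := enorm (y 1%N - y 0%N) in
    let G := Num.sqrt (2 * L * n%:R * (f z0 - fbar)) in
    [/\ enorm (y m.+1 - y m) <= beta ^+ m * V + C * alpha * (V + G),
        f z1 <= f z0 - m%:R * C0 / 2 * (alpha * enorm (grad f z0) ^+ 2)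
                + C * alpha * (V + alpha * G) ^+ 2 &
        `|enorm (grad f z1) - enorm (grad f z0)| <= C * alpha * (V + G)].
Proof.
move=> Fb LA.
pose kappa := 1 + 2 * A * L * C0 ^+ 2 + 2 * C0.
have kappa0 : 0 <= kappa.
  by rewrite /kappa !addr_ge0 ?mulr_ge0 ?sqr_ge0// ltW.
(* [D] makes [L E = D (V + alpha G)]; [H] then controls the length of the proxy step, and [Q] the
   error in the descent inequality. *)
pose D := L * C0 * kappa ^+ m.
have D0 : 0 <= D by rewrite !mulr_ge0 ?exprn_ge0// ltW.
pose H := m%:R * C0 * (D * (1 + A) + 1).
have mp : 0 < m%:R :> R by rewrite ltr0n.
have DA : 1 <= D * (1 + A) + 1 by rewrite lerDr mulr_ge0// addr_ge0// ltW.
have H0 : 0 < H by rewrite !mulr_gt0// (lt_le_trans ltr01).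
pose Q := m%:R * C0 / 2 * D ^+ 2.
have Q0 : 0 <= Q.
  by apply: mulr_ge0; [rewrite divr_ge0 ?mulr_ge0// ltW|exact: sqr_ge0].
have LH : 0 < L * H by exact: mulr_gt0.
(* [H] serves the velocity, [Q] the descent, and [L * H] the change of the gradient. *)
exists (H + L * H + Q); first by rewrite ltr_wpDr// addr_gt0.
move=> alpha pk y alpha0 alphaA pkn yS z0 z1 V G.
have G0 : 0 <= G by exact: sqrtr_ge0.
have V0 : 0 <= V by exact: enorm_ge0.
have gG j : (j < n)%N ->
    enorm (grad (F j) (y 1%N + (beta / (1 - beta)) *: (y 1%N - y 0%N))) <= G.
  by rewrite -proxyE; exact: grad_component_le.
have yS' i : (i < m)%N ->
    y i.+2 = y i.+1 - alpha *: batch_dir F b pk i.+1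
      (y i.+1 + lambda *: (y i.+1 - y i)) + beta *: (y i.+1 - y i).
  by move=> im; exact: (yS i.+1).
have hw := velocity_end alpha0 alphaA pkn yS' G0 gG.
have hz := proxy_step alpha0 alphaA pkn yS' G0 gG.
have Ltau : L * (m%:R * alpha * C0) <= 1.
  apply: le_trans LA; rewrite ler_pM2l// ler_pM2r// ler_pM2l//.
have hf := proxy_descent alpha0 alphaA pkn yS' G0 gG Ltau.
rewrite -!proxyE -/z0 -/z1 -/V -/C0 -/kappa in hw hz hf.
have DW : L * (C0 * kappa ^+ m * (V + alpha * G)) = D * (V + alpha * G).
  by rewrite !mulrA.
rewrite DW in hw hz hf.
have HVG : D * (V + alpha * G) + G <= (D * (1 + A) + 1) * (V + G).
  have h1 : alpha * (D * G) <= A * (D * G) by rewrite ler_wpM2r// mulr_ge0.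
  have h2 : 0 <= A * (D * V) by exact: mulr_ge0 (ltW A0) (mulr_ge0 D0 V0).
  have h3 : 0 <= D * G by exact: mulr_ge0.
  move: V0; lra.
have VG0 : 0 <= V + G by rewrite addr_ge0.
have aVG : 0 <= alpha * (V + G) by rewrite mulr_ge0// ltW.
have maC : 0 <= m%:R * alpha * C0 by rewrite !mulr_ge0// ltW.
have step : m%:R * alpha * C0 * (D * (V + alpha * G) + G) <= H * (alpha * (V + G)).
  have -> : H * (alpha * (V + G)) =
    m%:R * alpha * C0 * ((D * (1 + A) + 1) * (V + G)) by rewrite /H; ring.
  by rewrite ler_wpM2l.
have LH0 : 0 <= L * H * (alpha * (V + G)) by exact: mulr_ge0 (ltW LH) aVG.
have QV0 : 0 <= Q * (alpha * (V + G)) by exact: mulr_ge0.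
have HV0 : 0 <= H * (alpha * (V + G)) by exact: mulr_ge0 (ltW H0) aVG.
split.
- apply: le_trans hw _; rewrite lerD2l.
  (* Inserting [C0 >= 1] lets the estimate for the proxy step serve the velocity too. *)
  apply: (@le_trans _ _ (m%:R * alpha * C0 * (D * (V + alpha * G) + G))).
    rewrite ler_wpM2r//; first by rewrite addr_ge0// mulr_ge0// addr_ge0// mulr_ge0// ltW.
    by rewrite ler_peMr// mulr_ge0// ltW.
  by apply: le_trans step _; lra.
- apply: le_trans hf _; rewrite lerD2l exprMn mulrA.
  rewrite ler_wpM2r ?sqr_ge0// mulrAC ler_wpM2r ?(ltW alpha0)//.
  by rewrite -/Q; move: (ltW H0) (ltW LH); lra.
- apply: le_trans (ler_dist_enorm _ _) _.
  apply: le_trans (lipschitz_grad_favg n0 dF lF _ _) _.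
  have := ler_wpM2l (ltW L0) (le_trans hz step); lra.
Qed.

End Epoch.

(** * Transfer to the iterates and the convergence theorem *)

Lemma sum_from1 (R : realType) (u : nat -> R) T :
  \sum_(1 <= k < T.+1) u k = series (fun k => u k.+1) T.
Proof. by rewrite big_add1. Qed.

(** The descent inequality in both directions with Cauchy-Schwarz; it carries the limit of [f (z k)]
    over to [f (x k)]. *)
Lemma value_gap_le (R : realType) (d : nat) (g : 'rV[R]_d -> R) (L : R) :
  (forall u, differentiable g u) -> lipschitz_grad L g -> forall u w,
  `|g u - g w| <= (enorm (grad g u) + enorm (grad g w)) * enorm (u - w)
                  + L / 2 * enorm (u - w) ^+ 2.
Proof.
move=> dg lg u w.
have h1 := smooth_descent dg lg u w; have h2 := smooth_descent dg lg w u.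
have h3 := dotv_le_enorm (grad g w) (u - w).
have h4 := dotv_le_enorm (grad g u) (w - u).
rewrite (enormB_sym w u) in h2 h4.
have h5 := mulr_ge0 (enorm_ge0 (grad g u)) (enorm_ge0 (u - w)).
have h6 := mulr_ge0 (enorm_ge0 (grad g w)) (enorm_ge0 (u - w)).
rewrite ler_norml; lra.
Qed.

Theorem theorem5p1 (R : realType) (n d b : nat) (F : nat -> 'rV[R]_d -> R)
  (L fbar beta lambda : R) (alpha : nat -> R)
  (pi : nat -> seq nat)
  (x xt : nat -> 'rV[R]_d) (y : nat -> nat -> 'rV[R]_d) :
  (* n, b in N, m := n / b in N *)
  (0 < n)%N -> (0 < b)%N -> (b %| n)%N ->
  (* f_i continuously differentiable *)
  (forall i, (i < n)%N -> forall z, differentiable (F i) z) ->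
  (forall i, (i < n)%N -> continuous (grad (F i))) ->
  (* (A.a) *)
  0 < L ->
  (forall i, (i < n)%N -> forall u v,
      enorm (grad (F i) u - grad (F i) v) <= L * enorm (u - v)) ->
  (forall i, (i < n)%N -> forall z, fbar <= F i z) ->
  (* (A.b) and step-size conditions (steps indexed k = 1, 2, ...) *)
  (forall k, (1 <= k)%N -> alpha k.+1 <= alpha k) ->
  (forall k, (1 <= k)%N -> 0 < alpha k) ->
  (forall k, (1 <= k)%N ->
     alpha k <= (1 - beta) * (1 - beta ^+ (n %/ b)) / (4 * L * (n %/ b)%:R)) ->
  ((fun T => \sum_(1 <= k < T) alpha k) @ \oo --> +oo) ->
  cvgn (fun T => \sum_(1 <= k < T) alpha k ^+ 3) ->
  (* parameters *)
  0 <= beta -> beta < 1 ->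
  0 <= lambda -> lambda <= beta / (1 - beta) ->
  (* the RRM iteration, with arbitrary permutations pi^k of [n] *)
  (forall k, (1 <= k)%N -> perm_eq (pi k) (iota 0 n)) ->
  xt 1%N = x 1%N ->
  (forall k, (1 <= k)%N -> y k 0%N = xt k /\ y k 1%N = x k) ->
  (forall k i, (1 <= k)%N -> (1 <= i <= n %/ b)%N ->
     let yhat := y k i + lambda *: (y k i - y k i.-1) in
     y k i.+1 = y k i - alpha k *: batch_dir F b (pi k) i yhat
                + beta *: (y k i - y k i.-1)) ->
  (forall k, (1 <= k)%N -> xt k.+1 = y k (n %/ b)%N /\ x k.+1 = y k (n %/ b).+1) ->
  let f := favg n F in
  let z := fun k => (1 - beta)^-1 *: x k - (beta / (1 - beta)) *: xt k in
  (* (a) *)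
  (cvgn (fun T => \sum_(1 <= k < T) alpha k * enorm (grad f (x k)) ^+ 2)
   /\ ((fun T => (\sum_(1 <= k < T.+1) alpha k) *
         \big[Num.min/enorm (grad f (x 1%N)) ^+ 2]_(1 <= k < T.+1)
            enorm (grad f (x k)) ^+ 2) @ \oo --> 0))
  (* (b) *)
  /\ ((fun k => enorm (grad f (x k))) @ \oo --> 0
      /\ (fun k => enorm (grad f (z k))) @ \oo --> 0
      /\ (forall p, cluster (x @ \oo) p -> grad f p = 0)
      /\ (forall p, cluster (z @ \oo) p -> grad f p = 0))
  (* (c) *)
  /\ (exists fstar : R,
        (fun k => f (x k)) @ \oo --> fstar /\ (fun k => f (z k)) @ \oo --> fstar).
Proof.
move=> n0 b0 bn dF _ L0 lF Fb aS a0 aA ay ca3 beta0 beta1 lam0 lamb pkn _ y01 yS xS f z.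
set m := (n %/ b)%N in aA yS xS.
have m0 : (0 < m)%N by rewrite divn_gt0// dvdn_leq.
have mp : 0 < m%:R :> R by rewrite ltr0n.
have np : 0 < n%:R :> R by rewrite ltr0n.
have b1 : 0 < 1 - beta by rewrite subr_gt0.
have bm0 : 0 <= beta ^+ m by rewrite exprn_ge0.
have bm1 : beta ^+ m < 1 by rewrite exprn_ilt1// -lt0n.
(* The largest step allowed; it gives [L m A / (1 - beta) = (1 - beta ^+ m) / 4], below the
   threshold 1 of the epoch bounds. *)
pose A := (1 - beta) * (1 - beta ^+ m) / (4 * L * m%:R).
have A0 : 0 < A by rewrite divr_gt0 ?mulr_gt0// subr_gt0.
have LA : L * (m%:R * A * (1 - beta)^-1) <= 1.
  have -> : L * (m%:R * A * (1 - beta)^-1) = (1 - beta ^+ m) / 4.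
    by rewrite /A; field; rewrite !gt_eqF.
  by rewrite ler_pdivrMr// mul1r; move: bm0; lra.
have df u : differentiable f u by exact: differentiable_favg.
have lf : lipschitz_grad L f by exact: lipschitz_grad_favg.
have fb u : fbar <= f u.
  rewrite -subr_ge0 -(pmulr_rge0 _ np) favg_gap//.
  by apply: sumr_ge0 => i _; rewrite subr_ge0 Fb.
have [C C0 HC] := epoch_bounds n0 b0 bn dF L0 lF beta0 beta1 lam0 lamb A0 Fb LA.
(* Epochs are renumbered from 0 to match [series]. *)
pose a k := alpha k.+1.
pose phi k := f (z k.+1) - fbar.
pose V k := enorm (x k.+1 - xt k.+1).
pose G k := Num.sqrt (2 * L * n%:R * phi k).
pose h k := enorm (grad f (z k.+1)).
(* Enlarged so that [G k ^+ 2 = 2 L n phi k] is also bounded by [C' phi k]. *)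
pose C' := C + 2 * L * n%:R.
have Ln : 0 < 2 * L * n%:R by rewrite !mulr_gt0.
have C'0 : 0 < C' by rewrite addr_gt0.
have CC' : C <= C' by rewrite lerDl ltW.
have V0 k : 0 <= V k by exact: enorm_ge0.
have h0 k : 0 <= h k by exact: enorm_ge0.
have phi0 k : 0 <= phi k by rewrite subr_ge0.
have G0 k : 0 <= G k by exact: sqrtr_ge0.
have ap k : 0 < a k by exact: a0.
have step k := HC (a k) (pi k.+1) (y k.+1) (ap k) (aA k.+1 isT)
  (pkn k.+1 isT) (fun i => yS k.+1 i isT).
have zE k : proxy beta (x k) (xt k) = z k by [].
have widen (s t : R) k : s <= C * a k * t -> 0 <= t -> s <= C' * a k * t.
  move=> /le_trans + t0; apply; rewrite ler_wpM2r// ler_wpM2r//; exact: ltW.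
have stepV k : V k.+1 <= beta ^+ m * V k + C' * a k * (V k + G k).
  have [+ _ _] := step k.
  have [-> ->] := y01 k.+1 isT; have [<- <-] := xS k.+1 isT.
  rewrite -lerBlDl => /widen /(_ (addr_ge0 (V0 k) (G0 k))).
  by rewrite lerBlDl.
have stepphi k : phi k.+1 <= phi k - m%:R / (1 - beta) / 2 * (a k * h k ^+ 2)
    + C' * a k * (V k + a k * G k) ^+ 2.
  have [_ + _] := step k.
  have [-> ->] := y01 k.+1 isT; have [<- <-] := xS k.+1 isT.
  rewrite -lerBlDl => /widen /(_ (sqr_ge0 _)).
  rewrite /= -/m -/f !zE -/(V k) -/(phi k) -/(G k) -/(h k) -/(a k) /phi; lra.
have steph k : `|h k.+1 - h k| <= C' * a k * (V k + G k).
  have [_ _ +] := step k.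
  have [-> ->] := y01 k.+1 isT; have [<- <-] := xS k.+1 isT.
  by move=> /widen /(_ (addr_ge0 (V0 k) (G0 k))).
have Gphi k : G k ^+ 2 <= C' * phi k.
  rewrite sqr_sqrtr; last by rewrite mulr_ge0// ltW.
  by rewrite ler_wpM2r// lerDr ltW.
have ay' : series a @ \oo --> +oo.
  have -> : series a = fun T => \sum_(1 <= k < T.+1) alpha k.
    by apply/funext => T; rewrite sum_from1.
  by rewrite (cvg_shiftS (fun T => \sum_(1 <= k < T) alpha k)).
have shift_cvg (u : nat -> R) : cvgn (fun T => \sum_(1 <= k < T) u k) <->
    cvgn (series (fun k => u k.+1)).
  have -> : series (fun k => u k.+1) = fun T => \sum_(1 <= k < T.+1) u k.
    by apply/funext => T; rewrite sum_from1.
  by split=> /cvg_ex[/= l ul]; apply/cvg_ex; exists l; move: ul;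
    rewrite (cvg_shiftS (fun T => \sum_(1 <= k < T) u k)).
(* The contraction factor [q] is [beta ^+ m], and [c0] is [m / (2 (1 - beta))]. *)
have [cphi cV ch cah caV] := lyapunov_cvg_eventually C'0
  (divr_gt0 (divr_gt0 mp b1) (ltr0Sn R 1)) (introT andP (conj bm0 bm1)) ap
  (fun k => aS k.+1 isT) phi0 V0 G0 h0 ay'
  ((shift_cvg (fun k => alpha k ^+ 3)).1 ca3) stepV stepphi Gphi steph.
pose c := beta / (1 - beta).
have c0 : 0 <= c by rewrite divr_ge0// ltW.
have xz k : enorm (x k.+1 - z k.+1) = c * V k.
  have -> : z k.+1 = proxy beta (x k.+1) (xt k.+1) by [].
  by rewrite proxyE// opprD addrA subrr sub0r enormN enormZ ger0_norm.
pose hx k := enorm (grad f (x k.+1)).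
have hx0 k : 0 <= hx k by exact: enorm_ge0.
have hxle k : hx k <= h k + L * c * V k.
  rewrite /hx -[grad f (x _)](subrK (grad f (z k.+1))) addrC.
  apply: le_trans (ler_enormD _ _) _; rewrite lerD2l -mulrA -xz.
  exact: lf.
have cvgLin (t : R) : (fun k => t * V k) @ \oo --> 0.
  by rewrite -[X in _ --> X](mulr0 t); exact: cvgM (cvg_cst _) cV.
have chx : hx @ \oo --> 0.
  apply: (@squeeze_cvgr _ _ _ _ (cst 0) (fun k => h k + L * c * V k)).
  - by near=> k; rewrite /= hx0 hxle.
  - exact: cvg_cst.
  - by rewrite -[X in _ --> X](addr0 0); exact: cvgD ch (cvgLin _).
have cahx : cvgn (series (fun k => a k * hx k ^+ 2)).
  (* Squares [hxle] with [(s + t)^2 <= 2 s^2 + 2 t^2], so that summability at [z] and of [a V^2]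
     gives summability at [x]. *)
  have dom k : a k * hx k ^+ 2 <=
      2 * (a k * h k ^+ 2) + 2 * (L * c) ^+ 2 * (a k * V k ^+ 2).
    have -> : 2 * (a k * h k ^+ 2) + 2 * (L * c) ^+ 2 * (a k * V k ^+ 2) =
      a k * (2 * h k ^+ 2 + 2 * (L * c * V k) ^+ 2) by ring.
    rewrite ler_pM2l//; apply: (@le_trans _ _ ((h k + L * c * V k) ^+ 2)).
      by rewrite ler_pXn2r ?nnegrE// (le_trans (hx0 k)).
    by have := sqr_ge0 (h k - L * c * V k); lra.
  apply: (series_le_cvg _ _ dom).
  - by move=> k; rewrite mulr_ge0 ?sqr_ge0// ltW.
  - by move=> k; apply: le_trans (dom k); rewrite mulr_ge0 ?sqr_ge0// ltW.
  - by apply: series_add_is_cvg; exact: series_scale_is_cvg.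
have cx : (fun k => enorm (grad f (x k))) @ \oo --> 0.
  by rewrite -cvg_shiftS; exact: chx.
have cz : (fun k => enorm (grad f (z k))) @ \oo --> 0.
  by rewrite -cvg_shiftS; exact: ch.
split; [split|split].
- exact/(shift_cvg (fun k => alpha k * enorm (grad f (x k)) ^+ 2)).
- under eq_fun do rewrite sum_from1 big_add1.
  exact: series_mul_bigmin_cvg0 ap (fun k => sqr_ge0 (hx k)) (sqr_ge0 _) ay' cahx.
- split; [exact: cx|split; [exact: cz|split=> p]].
    exact: (lipschitz_grad_cluster L0 lf cx).
  exact: (lipschitz_grad_cluster L0 lf cz).
have [l phil] := (cvg_ex _).1 cphi; rewrite /= in phil.
have fz : (fun k => f (z k.+1)) @ \oo --> l + fbar.
  have -> : (fun k => f (z k.+1)) = phi + cst fbar.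
    by apply/funext => k; rewrite fctE /phi subrK.
  exact: cvgD phil (cvg_cst _).
exists (l + fbar); split; last by rewrite -cvg_shiftS; exact: fz.
rewrite -cvg_shiftS.
(* Gradients and distance both tend to 0, hence so does the difference of the values at [x] and
   [z]. *)
have gap : (fun k => f (x k.+1) - f (z k.+1)) @ \oo --> 0.
  apply: norm_cvg0.
  apply: (@squeeze_cvgr _ _ _ _ (cst 0)
    (fun k => (hx k + h k) * (c * V k) + L / 2 * (c * V k) ^+ 2)).
  - near=> k; rewrite /= normr_ge0 /= -xz; exact: value_gap_le.
  - exact: cvg_cst.
  - have -> : 0 = (0 + 0) * 0 + L / 2 * 0 ^+ 2 :> R by ring.
    have cc := cvgLin c.
    exact: cvgD (cvgM (cvgD chx ch) cc) (cvgM (cvg_cst _) (cvgM cc cc)).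
have -> : [sequence f (x k.+1)]_k =
    (fun k => f (x k.+1) - f (z k.+1)) + (fun k => f (z k.+1)).
  by apply/funext => k; rewrite fctE subrK.
by rewrite -[l + fbar]add0r; exact: cvgD gap fz.
Unshelve. all: by end_near. Qed.
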